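(* Let $k\ge 2$, $\mathcal{A}=\{0,1,\dots,k-1\}$, $T=\mathcal{A}^{<\mathbb{N}}$, let $Z\subseteq T$ be finite, and let $W=\bigcup_{p\in Z}[T_p]$ be a minimal-size open winning set, i.e. $\sum_{p\in Z}|\mathcal{A}|^{-\lfloor \mathrm{len}(p)/2\rfloor}=1$. Let $M_k$ be the set of all functions $\mathcal{A}\to\mathcal{A}$, and for $x=\langle x_1,x_2,\dots\rangle\in(M_k)^{\mathbb{N}}$ and a position $p=\langle a_1,\dots,a_n\rangle$ define $$c_x(p)=\langle c_x^1(p),\dots,c_x^{\lfloor n/2\rfloor}(p)\rangle,\qquad c_x^i(p)=x_i(a_{2i-1})+a_{2i}\pmod k,$$ and $C_x(Z')=\{c_x(p):p\in Z'\}$ for $Z'\subseteq Z$. Suppose there exists $x\in(M_k)^{\mathbb{N}}$ such that for every subset $Z'\subseteq Z$ of cardinality $$\Bigl(\max_{p\in Z}\Bigl\lfloor\frac{\mathrm{len}(p)}{2}\Bigr\rfloor\Bigr)\cdot(|\mathcal{A}|-1)+1$$ the subgroup $H=\langle C_x(Z')\rangle$ generated by $C_x(Z')$ has infinite index in the free group $F(\mathcal{A})$, i.e. $[F(\mathcal{A}):H]=\infty$. Then Player 2 has a winning strategy in the game $(T,W)$.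
   Context: $\mathcal{A}^{<\mathbb{N}}$ is the set of all finite sequences over $\mathcal{A}$ (including the empty sequence); its elements are called positions, and $\mathrm{len}(p)$ is the length of $p$. $F(\mathcal{A})$ is the free group with basis $\mathcal{A}$ (the symbols $0,\dots,k-1$ are free generators), and a finite sequence $\langle b_1,\dots,b_m\rangle$ over $\mathcal{A}$ is identified with the element $b_1b_2\cdots b_m$ of $F(\mathcal{A})$. A play is an infinite sequence in $\mathcal{A}^{\mathbb{N}}$; $[T]=\mathcal{A}^{\mathbb{N}}$ is the set of plays, and for $p\in T$, $[T_p]$ is the set of plays having $p$ as a prefix. In the game $(T,W)$ with $W\subseteq[T]$, two players alternately choose actions in $\mathcal{A}$, with Player 1 moving at positions of even length (in particular first) and Player 2 at positions of odd length, each knowing all previous moves; Player 1 wins if the resulting play lies in $W$, and otherwise Player 2 wins. A strategy of Player 1 (Player 2) is a function assigning an action to every position of even (odd) length; it is winning if every play consistent with it is won by that player.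
   Formalization: It is additionally assumed that some p in Z has length at least 2; otherwise the sum condition forces Z={p} with len(p)≤1, where the trivial subgroup has infinite index yet Player 1 wins, so the printed claim fails. *)

(* Defs.v *)
From HB Require Import structures.
From mathcomp Require Import all_boot all_order all_algebra.
From mathcomp Require Import finmap boolp classical_sets cardinality.

Set Implicit Arguments.
Unset Strict Implicit.
Unset Printing Implicit Defensive.

Import Order.TTheory GRing.Theory Num.Theory.

Local Open Scope classical_set_scope.
Local Open Scope nat_scope.

(* The free group with basis T is the set of reduced words over T * bool, where
   (a, false) stands for a and (a, true) for its inverse. *)
Section FreeGroup.
Variable T : choiceType.
Implicit Types (l : T * bool) (u v w : seq (T * bool)).

Definition linv l := (l.1, ~~ l.2).

Definition reduced w := sorted (fun l l' => l' != linv l) w.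

Definition rcons_l l w :=
  if w is l' :: w' then if l' == linv l then w' else l :: w else [:: l].

Definition nf w := foldr rcons_l [::] w.

Definition winv w := rev (map linv w).

Lemma linvK : involutive linv.
Proof. by case=> a b; rewrite /linv /= negbK. Qed.

Lemma reduced_rcons_l l w : reduced w -> reduced (rcons_l l w).
Proof.
case: w => //= l' w; case: eqP => [_ /path_sorted//|/eqP ne rw] /=.
by rewrite ne.
Qed.

Lemma reduced_foldr u w : reduced w -> reduced (foldr rcons_l w u).
Proof. by move=> rw; elim: u => //= l u /reduced_rcons_l. Qed.

Lemma reduced_nf w : reduced (nf w).
Proof. exact: reduced_foldr. Qed.

Lemma rcons_lK l w : reduced w -> rcons_l (linv l) (rcons_l l w) = w.
Proof.
case: w => [|l' w] /=; first by rewrite linvK eqxx.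
case: eqP => [->|_ _] /=; last by rewrite linvK eqxx.
case: w => [|l'' w] //= /andP[/negPf ne _].
by rewrite ne.
Qed.

Lemma rcons_l_reduced l w : reduced (l :: w) -> rcons_l l w = l :: w.
Proof. by case: w => //= l' w /andP[/negPf ->]. Qed.

Lemma nf_id w : reduced w -> nf w = w.
Proof.
elim: w => //= l w IH r; rewrite IH ?rcons_l_reduced//.
exact: path_sorted r.
Qed.

Lemma foldr_rcons_l l u w : reduced w ->
  foldr rcons_l w (rcons_l l u) = rcons_l l (foldr rcons_l w u).
Proof.
move=> rw; case: u => //= l' u; case: eqP => //= ->.
by rewrite -{1}(linvK l) rcons_lK// reduced_foldr.
Qed.

Lemma foldr_nf u w : reduced w -> foldr rcons_l w (nf u) = foldr rcons_l w u.
Proof. by move=> rw; elim: u => //= l u <-; rewrite foldr_rcons_l. Qed.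

Lemma nf_catl u v : nf (nf u ++ v) = nf (u ++ v).
Proof. by rewrite /nf !foldr_cat foldr_nf// reduced_nf. Qed.

Lemma nf_catr u v : nf (u ++ nf v) = nf (u ++ v).
Proof. by rewrite /nf !foldr_cat -/(nf v) -/(nf (nf v)) nf_id// reduced_nf. Qed.

Lemma nf_winvl w : nf (winv w ++ w) = [::].
Proof.
elim: w => //= l w IH.
rewrite /winv /= rev_cons cat_rcons /nf foldr_cat /= -/(nf w).
by rewrite rcons_lK ?reduced_nf// /nf -foldr_cat.
Qed.

Lemma winvK : involutive winv.
Proof. by move=> w; rewrite /winv map_rev revK mapK//; exact: linvK. Qed.

Lemma nf_winvr w : nf (w ++ winv w) = [::].
Proof. by rewrite -{1}(winvK w) nf_winvl. Qed.

Record free_group := FreeGroup {fg_word :> seq (T * bool); _ : reduced fg_word}.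

HB.instance Definition _ := [isSub for fg_word].
HB.instance Definition _ := [Choice of free_group by <:].

Implicit Types g h : free_group.

Definition fg_of_word w : free_group := FreeGroup (reduced_nf w).
Definition fg_mul g h := fg_of_word (g ++ h).
Definition fg_one := fg_of_word [::].
Definition fg_inv g := fg_of_word (winv g).

Lemma fg_mulA : associative fg_mul.
Proof. by move=> f g h; apply: val_inj; rewrite /= nf_catl nf_catr catA. Qed.

Lemma fg_mul1 : left_id fg_one fg_mul.
Proof. by move=> [w r]; apply: val_inj; rewrite /= nf_id. Qed.

Lemma fg_mulr1 : right_id fg_one fg_mul.
Proof. by move=> [w r]; apply: val_inj; rewrite /= cats0 nf_id. Qed.

Lemma fg_mulV : left_inverse fg_one fg_inv fg_mul.
Proof. by move=> g; apply: val_inj; rewrite /= nf_catl nf_winvl. Qed.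

Lemma fg_mulrV : right_inverse fg_one fg_inv fg_mul.
Proof. by move=> g; apply: val_inj; rewrite /= nf_catr nf_winvr. Qed.

HB.instance Definition _ :=
  isGroup.Build free_group fg_mulA fg_mul1 fg_mulr1 fg_mulV fg_mulrV.

Definition fg_gen (a : T) : free_group := fg_of_word [:: (a, false)].

Definition fg_seq (s : seq T) : free_group :=
  (\big[*%g/1%g]_(a <- s) fg_gen a)%g.

End FreeGroup.

Section Subgroups.
Variable G : groupType.

Definition is_subgroup (H : set G) :=
  [/\ H 1%g, (forall g h, H g -> H h -> H (g * h)%g)
    & (forall g, H g -> H (g^-1)%g)].

Definition subgroup_gen (S : set G) : set G := smallest is_subgroup S.

Definition lcoset (g : G) (H : set G) : set G := [set (g * h)%g | h in H].

Definition infinite_index (H : set G) :=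
  infinite_set [set lcoset g H | g in [set: G]].

End Subgroups.

Section Game.
Variable k : nat.

Local Notation action := 'I_k.
Definition position := seq action.
Definition play := nat -> action.

Definition cylinder (p : position) : set play :=
  [set f | mkseq f (size p) = p].

Definition cylinders (Z : {fset position}) : set play :=
  \bigcup_(p in [set` Z]) cylinder p.

(* A strategy of Player 2 is applied only to positions of odd length; its
   values at the other positions are irrelevant. *)
Definition strategy := position -> action.

Definition consistent2 (s : strategy) : set play :=
  [set f | forall n, odd n -> f n = s (mkseq f n)].

Definition player2_has_winning_strategy (W : set play) :=
  exists s : strategy, forall f, consistent2 s f -> ~ W f.

(* For k >= 2 and Z such that the sum over p in Z of k ^- (len p)./2 is 1, this
   is 0 iff Z is a singleton {p} with len p <= 1.  Player 1 then wins, although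
   {p} is sent to the trivial subgroup, which has infinite index: this case has
   to be excluded. *)
Definition max_half_len (Z : {fset position}) : nat :=
  \max_(p <- Z) (size p)./2.

Definition add_mod (a b : action) : action :=
  Ordinal (ltn_pmod (a + b) (leq_ltn_trans (leq0n a) (ltn_ord a))).

(* The sequence x is indexed from 0, and a last unpaired action is dropped;
   nth_cseq gives the closed form of the entries. *)
Fixpoint cseq (x : nat -> {ffun action -> action}) (p : position) : seq action :=
  if p is a :: b :: p' then add_mod (x 0 a) b :: cseq (fun i => x i.+1) p'
  else [::].

Lemma cseqP x p : size (cseq x p) = (size p)./2 /\
  forall a0 i, i < (size p)./2 ->
  nth a0 (cseq x p) i = add_mod (x i (nth a0 p i.*2)) (nth a0 p i.*2.+1).
Proof.
have [n] := ubnP (size p); elim: n x p => // n IH x [|a [|b p]] //= lt.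
have [] := IH (fun i => x i.+1) p; first by rewrite -ltnS ltnW.
by move=> -> nthE; split=> // a0 [|i] //= /nthE ->.
Qed.

Lemma size_cseq x p : size (cseq x p) = (size p)./2.
Proof. exact: (cseqP x p).1. Qed.

Lemma nth_cseq x p a0 i : i < (size p)./2 ->
  nth a0 (cseq x p) i = add_mod (x i (nth a0 p i.*2)) (nth a0 p i.*2.+1).
Proof. exact: (cseqP x p).2. Qed.

Definition Cset (x : nat -> {ffun action -> action}) (Z' : {fset position}) :
  set (free_group action) := [set fg_seq (cseq x p) | p in [set` Z']].

End Game.

(* Main.v *)
Require Import Defs.
From mathcomp Require Import all_boot all_order all_algebra.
From mathcomp Require Import finmap boolp classical_sets cardinality.

(* If some y in A^N has no prefix in C_x(Z), Player 2 wins by answering so that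
   c_x of the play is y.  Otherwise the words c_x(p) cover A^N; as their measures
   sum to 1, c_x is injective on Z and C = C_x(Z) is a complete prefix code.  Let
   n be the length of its longest words.  Some b^m is in C, and along it there
   are leaves b^e a b^r of C for all e < m and a != b: these m(k-1)+1 <= n(k-1)+1
   words generate a subgroup H all of whose cosets are among b^i H, i < m.  Taking
   instead the leaves along a longest word shows that C has at least n(k-1)+1
   elements, so that this subset can be enlarged to one of the size at which the
   hypothesis applies, and its index is still finite. *)

Set Implicit Arguments.
Unset Strict Implicit.
Unset Printing Implicit Defensive.

Import Order.TTheory GRing.Theory Num.Theory.

(** * A coset criterion for finite index in a free group *)

Section FiniteIndex.
Local Open Scope classical_set_scope.
Local Open Scope group_scope.

Lemma is_subgroup_gen (G : groupType) (S : set G) :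
  is_subgroup (subgroup_gen S).
Proof.
split=> [H [[]]//|g h Hg Hh H SH|g Hg H SH].
  by have [[_ HM _] _] := SH; apply: HM; [exact: Hg | exact: Hh].
by have [[_ _ HV] _] := SH; apply: HV; exact: Hg.
Qed.

Lemma eq_lcoset (G : groupType) (H : set G) (g h : G) :
  is_subgroup H -> H (g^-1 * h) -> lcoset g H = lcoset h H.
Proof.
move=> [_ HM HV] Hgh; apply/seteqP; split=> _ [u Hu <-].
  exists ((g^-1 * h)^-1 * u); first by apply: HM => //; exact: HV.
  by rewrite invgM invgK !mulgA mulgV mul1g.
by exists (g^-1 * h * u); [exact: HM | rewrite !mulgA mulgV mul1g].
Qed.

Lemma free_group_ind (A : choiceType) (P : free_group A -> Prop) : P 1 ->
  (forall a g, P g -> P (fg_gen a * g)) ->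
  (forall a g, P g -> P ((fg_gen a)^-1 * g)) -> forall g, P g.
Proof.
(* Writing [g] as [fg_of_word] of a list spares the induction the reducedness of tails. *)
move=> P1 PM PV g; have -> : g = fg_of_word (fg_word g).
  by apply: val_inj; rewrite /= nf_id//; case: g.
elim: (fg_word g) => // [[a b] w IH].
case: b.
  suff -> : fg_of_word ((a, true) :: w) = (fg_gen a)^-1 * fg_of_word w.
    exact: PV.
  by apply: val_inj; rewrite /= [nf (nf _)]nf_id ?reduced_nf.
suff -> : fg_of_word ((a, false) :: w) = fg_gen a * fg_of_word w by exact: PM.
by apply: val_inj; rewrite /= [nf (nf _)]nf_id ?reduced_nf.
Qed.

(* The inverses of the generators permute a finite set of cosets, being
   injective on it, so that the generators preserve it as well. *)
Lemma finite_index_free_group (A : choiceType) (H : set (free_group A)) (m : nat)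
    (r : 'I_m -> free_group A) :
  is_subgroup H -> (exists i, H (r i)) ->
  (forall a i, exists j, H ((r j)^-1 * ((fg_gen a)^-1 * r i))) ->
  ~ infinite_index H.
Proof.
move=> sgH [i0 Hi0] rV; have [_ HM HV] := sgH.
(* [T] is the union of the cosets [r j H]; it turns out to be the whole group. *)
pose T g := exists j, H ((r j)^-1 * g).
have TV a g : T g -> T ((fg_gen a)^-1 * g).
  move=> [i Hi]; have [j Hj] := rV a i; exists j.
  by have := HM _ _ Hj Hi; rewrite !mulgA mulgK.
have TX a g e : T g -> T ((fg_gen a)^-1 ^+ e * g).
  by move=> Tg; elim: e => [|e IH]; rewrite ?mul1g// expgS -mulgA; exact: TV.
have TM a g : T g -> T (fg_gen a * g).
  move=> Tg; have [f fP] := choice (fun e => TX a g e Tg).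
  (* Pigeonhole: [m + 1] powers of the inverse generator, applied to [g], land in [m] cosets. *)
  have [e [d fed]] : exists e d, f e = f (e + d.+1)%N.
    pose F (i : 'I_m.+1) := f i.
    have /injectivePn[x [y nxy Fxy]] : ~~ injectiveb F.
      by apply/negP => /injectiveP /leq_card; rewrite !card_ord ltnn.
    wlog lt : x y nxy Fxy / (x < y)%N => [W|].
      have [lt|lt|/val_inj eqxy] := ltngtP x y; last by rewrite eqxy eqxx in nxy.
        exact: W lt.
      by apply: W lt => //; rewrite eq_sym.
    by exists x, (y - x).-1; rewrite prednK ?subn_gt0// subnKC 1?ltnW.
  (* Equal cosets put [g^-1 a^(d+1) g] in [H], so [a g] lies in the coset of [a^-d g], which is one
     of the [r j H]. *)
  have He := fP e; have Hed := fP (e + d.+1)%N; rewrite -fed in Hed.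
  have [j Hj] := TX a g d Tg; exists j.
  have := HM _ _ (HM _ _ Hj (HV _ Hed)) He.
  rewrite expgnDr expgS -!mulgA !invgM !invgK -!mulgA.
  by rewrite !mulVKg mulKg.
have Tall g : T g.
  apply: (free_group_ind (P := T)) => //.
  by exists i0; rewrite mulg1; exact: HV.
apply; apply: (@sub_finite_set _ _ [set lcoset (r j) H | j in [set: 'I_m]]).
  by move=> _ [g _ <-]; have [j Hj] := Tall g; exists j => //; exact: eq_lcoset.
exact/finite_image/finite_finset.
Qed.

End FiniteIndex.

(** * Codewords branching off a word of a complete prefix code *)

Section PrefixCode.
Variables (A : finType) (C : {fset seq A}).

Definition prefix_free := {in C &, forall c d, prefix c d -> c = d}.

Definition complete_code :=
  forall y : nat -> A, exists2 c, c \in C & mkseq y (size c) = c.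

Hypotheses (prefC : prefix_free) (complC : complete_code).

(** Some codeword is a prefix of the infinite word [take j v, a, b, b, ...]. It is longer than [j],
    since otherwise it would be a proper prefix of [v]; so it reaches the letter [a] and continues
    with [b] only. *)
Lemma side_leaf (v : seq A) (a b : A) (j : nat) :
  v \in C -> j < size v -> a != nth b v j ->
  exists r, take j v ++ a :: nseq r b \in C.
Proof.
move=> Cv ltj nva; set u := rcons (take j v) a.
have szu : size u = j.+1 by rewrite size_rcons size_take ltj.
(* The default [b] makes [nth b u] the word [u] followed by [b] forever. *)
have [c Cc] := complC (nth b u); set l := size c => cE.
have [lec|ltc] := leqP l j.
  have pcv : prefix c v.
    rewrite prefixE -/l -cE; apply/eqP/(@eq_from_nth _ b).
      by rewrite size_take size_mkseq (leq_ltn_trans lec ltj).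
    move=> i; rewrite size_take (leq_ltn_trans lec ltj) => lti.
    rewrite nth_mkseq// nth_take// nth_rcons size_take ltj.
    by rewrite (leq_trans lti lec) nth_take// (leq_trans lti lec).
  have ec := prefC Cc Cv pcv.
  by move: lec; rewrite /l ec leqNgt ltj.
exists (l - j.+1); suff -> : take j v ++ a :: nseq (l - j.+1) b = c by [].
rewrite -cE -cat_rcons -/u; apply: (@eq_from_nth _ b).
  by rewrite size_cat szu size_nseq size_mkseq subnKC.
move=> i; rewrite size_cat szu size_nseq subnKC// => lti.
rewrite nth_mkseq// nth_cat szu; case: ltnP => // lei.
by rewrite nth_nseq if_same nth_default// szu.
Qed.

(** At each position of [v], each of the [#|A| - 1] other letters starts a branch ending in a
    codeword. The summand 1 counts [v] itself. *)
Lemma leaves_along (v : seq A) (b : A) : v \in C ->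
  exists D : {fset seq A}, [/\ (D `<=` C)%fset, v \in D,
    #|` D|%fset = size v * (#|A| - 1) + 1 &
    forall j a, j < size v -> a != nth b v j ->
      exists r, take j v ++ a :: nseq r b \in D].
Proof.
move=> Cv; pose S := [pred q : 'I_(size v) * A | q.2 != nth b v q.1].
have [r rP] : {r : 'I_(size v) * A -> nat | forall q, q \in S ->
    take q.1 v ++ q.2 :: nseq (r q) b \in C}.
  suff /choice[r rP] : forall q : 'I_(size v) * A, exists n, q \in S ->
    take q.1 v ++ q.2 :: nseq n b \in C by exists r.
  move=> q; case: (boolP (q \in S)) => [Sq|_]; last by exists 0.
  by have [n ?] := side_leaf Cv (ltn_ord q.1) Sq; exists n.
pose leaf (q : 'I_(size v) * A) := take q.1 v ++ q.2 :: nseq (r q) b.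
have szt (q : 'I_(size v) * A) : size (take q.1 v) = q.1.
  by rewrite size_take ltn_ord.
have leaf_lt (q : 'I_(size v) * A) i : i < q.1 -> nth b (leaf q) i = nth b v i.
  by move=> lt; rewrite nth_cat szt lt nth_take.
have leaf_eq q : nth b (leaf q) q.1 = q.2 by rewrite nth_cat szt ltnn subnn.
(* If [leaf q'] branched off later than [leaf q], it would agree with [v] at [q.1], where [leaf q]
   does not. *)
have leaf_le q q' : q \in S -> leaf q = leaf q' -> q'.1 <= q.1.
  move=> Sq E; rewrite leqNgt; apply/negP => lt; move: Sq.
  by rewrite inE -(leaf_eq q) E leaf_lt// eqxx.
have leaf_inj : {in S &, injective leaf}.
  move=> q q' Sq Sq' E.
  have e1 : q.1 = q'.1.
    by apply/val_inj/eqP; rewrite eqn_leq !leaf_le.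
  have e2 : q.2 = q'.2 by rewrite -(leaf_eq q) E e1 leaf_eq.
  by rewrite [q]surjective_pairing e1 e2 -surjective_pairing.
have cardS : #|S| = size v * (#|A| - 1).
  rewrite -sum1_card (eq_bigl (fun q : 'I_(size v) * A =>
    xpredT q.1 && (q.2 != nth b v q.1)))//.
  rewrite -(pair_big_dep xpredT (fun i a => a != nth b v (val i)) (fun _ _ => 1)).
  rewrite /= -[in RHS](card_ord (size v)) -sum_nat_const; apply: eq_bigr => i _.
  by rewrite sum1_card subn1 -(cardC1 (nth b v i)).
pose s := v :: [seq leaf q | q in S].
have s_uniq : uniq s.
  rewrite /= map_inj_in_uniq ?enum_uniq ?andbT; last first.
    by move=> q q'; rewrite !mem_enum; exact: leaf_inj.
  apply/negP => /mapP[q]; rewrite mem_enum => Sq /esym vE; move: Sq.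
  by rewrite inE -(leaf_eq q) vE eqxx.
exists [fset x in s]%fset; split.
- apply/fsubsetP => x; rewrite !inE => /orP[/eqP->//|/mapP[q]].
  by rewrite mem_enum => Sq ->; exact: rP.
- by rewrite !inE eqxx.
- by rewrite card_fseq undup_id//= size_map -cardE cardS addn1.
- move=> j a ltj nva; exists (r (Ordinal ltj, a)).
  rewrite !inE; apply/orP; right; apply/mapP; exists (Ordinal ltj, a) => //.
  by rewrite mem_enum inE.
Qed.

End PrefixCode.

Lemma fsubset_card_between (K : choiceType) (D C : {fset K}) (n : nat) :
  (D `<=` C)%fset -> #|` D|%fset <= n <= #|` C|%fset ->
  exists E : {fset K}, [/\ (D `<=` E)%fset, (E `<=` C)%fset & #|` E|%fset = n].
Proof.
move=> DC /andP[leD leC].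
elim: n leD leC => [|n IH] leD leC.
  exists D; split; rewrite ?fsubset_refl//.
  by apply/eqP; rewrite -leqn0.
move: leD; rewrite leq_eqVlt => /orP[/eqP e|leD].
  by exists D; split; rewrite ?fsubset_refl.
have [E [DE EC cE]] := IH leD (ltnW leC).
have /fsubsetPn[x Cx nEx] : ~~ (C `<=` E)%fset.
  by apply/negP => /fsubset_leq_card; rewrite cE leqNgt leC.
exists (x |` E)%fset; split.
- exact/(fsubset_trans DE)/fsubsetU1.
- by rewrite fsubUset fsub1set Cx.
- by rewrite cardfsU1 nEx cE.
Qed.

(** * Subgroups generated by codewords *)

Section CodeSubgroup.
Local Open Scope classical_set_scope.
Local Open Scope group_scope.

Lemma fg_seq_cat (A : choiceType) (u v : seq A) :
  fg_seq (u ++ v) = fg_seq u * fg_seq v.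
Proof. by rewrite /fg_seq big_cat. Qed.

Lemma fg_seq_nseq (A : choiceType) (n : nat) (a : A) :
  fg_seq (nseq n a) = fg_gen a ^+ n.
Proof. by rewrite /fg_seq big_nseq iter_mulg_1. Qed.

(* If i + e = 0 mod m then a^-1 b^i H = a^-1 b^-e H = b^r H. *)
Lemma comb_finite_index (A : finType) (H : set (free_group A)) (b : A) (m : nat) :
  is_subgroup H -> (0 < m)%N -> H (fg_gen b ^+ m) ->
  (forall e a, (e < m)%N -> a != b ->
    exists r, H (fg_gen b ^+ e * (fg_gen a * fg_gen b ^+ r))) ->
  ~ infinite_index H.
Proof.
move=> sgH m0 Hbm Hleaf; have [H1 HM HV] := sgH.
have HX g n : H g -> H (g ^+ n).
  by move=> Hg; elim: n => // n IH; rewrite expgS; exact: HM.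
apply: (finite_index_free_group (r := fun i : 'I_m => fg_gen b ^+ i)) => //.
  by exists (Ordinal m0).
move=> a i; pose e := ((m - i) %% m)%N.
have He : H (fg_gen b ^+ (e + i)).
  rewrite /e; have [i0|i0] := posnP i; first by rewrite i0 subn0 modnn.
  by rewrite modn_small ?subnK ?ltn_subrL ?i0// ltnW.
have [r Hr] : exists r, H (fg_gen b ^+ e * (fg_gen a * fg_gen b ^+ r)).
  have [->|nab] := eqVneq a b; last by apply: Hleaf => //; rewrite ltn_pmod.
  (* This exponent turns the product into [b^(e+i) b^m]. *)
  exists (i + m.-1)%N; rewrite -expgS -expgnDr -addnS prednK// addnA.
  by rewrite expgnDr; exact: HM.
exists (Ordinal (ltn_pmod r m0)) => /=; set g := _ * fg_gen b ^+ i.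
have {}Hr : H ((fg_gen b ^+ r)^-1 * g).
  have := HM _ _ (HV _ Hr) He.
  by rewrite !invgM expgnDr -!mulgA mulKg.
(* The exponent [r] may exceed [m]; as [b^m] is in [H], only its residue matters for the coset. *)
rewrite [X in fg_gen b ^+ X](divn_eq r m) addnC expgnDr invgM -mulgA in Hr.
have := HM _ _ (HX _ (r %/ m)%N Hbm) Hr.
by rewrite -expgnA mulnC mulVKg.
Qed.

Lemma code_finite_index (A : finType) (C : {fset seq A}) (v : seq A) :
  prefix_free C -> complete_code C -> v \in C -> (0 < size v)%N ->
  {in C, forall c, size c <= size v}%N ->
  exists D : {fset seq A}, [/\ (D `<=` C)%fset,
    #|` D|%fset = (size v * (#|A| - 1) + 1)%N &
    ~ infinite_index (subgroup_gen [set fg_seq c | c in [set` D]])].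
Proof.
case: v => // b v0; set v := b :: v0 => prefC complC Cv _ maxv.
have [c Cc cE] := complC (fun=> b).
have {cE}cE : c = nseq (size c) b.
  rewrite -[LHS]cE; apply: (@eq_from_nth _ b); rewrite size_mkseq ?size_nseq//.
  by move=> i lti; rewrite nth_mkseq// nth_nseq lti.
(* An empty codeword would be a prefix of [v], hence equal to it. *)
have c0 : (0 < size c)%N.
  case: posnP => // /size0nil c0.
  by have := prefC _ _ Cc Cv; rewrite c0 prefix0s => /(_ isT).
have [D [DC Dc cardD leafD]] := leaves_along prefC complC b Cc.
(* [D'] bounds the size of [C] from below, leaving room to enlarge [D]. *)
have [D' [D'C _ cardD' _]] := leaves_along prefC complC b Cv.
have [|E [DE EC cardE]] :=
    fsubset_card_between (n := (size v * (#|A| - 1) + 1)%N) DC.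
  rewrite cardD leq_add2r leq_mul2r maxv// orbT /=.
  by rewrite -cardD'; exact: fsubset_leq_card.
exists E; split=> //; set H := subgroup_gen _.
have HE w : w \in D -> H (fg_seq w).
  move=> Dw; apply: sub_gen_smallest; exists w => //=.
  exact: (fsubsetP DE).
apply: (comb_finite_index (b := b) (m := size c)) => //.
- exact: is_subgroup_gen.
- by rewrite -fg_seq_nseq -cE; exact: HE.
move=> e a lte nab; have [|r Dr] := leafD e a lte.
  by rewrite cE nth_nseq lte.
exists r; have := HE _ Dr.
rewrite cE take_nseq ?(ltnW lte)// fg_seq_cat -cat1s fg_seq_cat !fg_seq_nseq.
by rewrite [fg_seq [:: a]]big_seq1.
Qed.

End CodeSubgroup.

(** * Kraft equality and covering imply prefix-freeness *)

Section Kraft.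

(** Such a tuple is determined by the letters after [u]. *)
Lemma card_prefix_tuple (A : finType) (u : seq A) (n : nat) :
  #|[pred t : n.-tuple A | prefix u t]| <= #|A| ^ (n - size u).
Proof.
have sz (t : n.-tuple A) : size (drop (size u) t) == n - size u.
  by rewrite size_drop size_tuple.
rewrite -(card_tuple (n - size u) A).
apply: (leq_card_in (fun t => Tuple (sz t))) => s t.
rewrite !inE => /prefixP[s' sE] /prefixP[t' tE] /(congr1 val) /=.
by rewrite sE tE !drop_size_cat// => st; apply: val_inj; rewrite /= sE tE st.
Qed.

(* Double counting of the pairs (p, t) where c p is a prefix of the n-tuple t:
   every t occurs, and there are at most #|A| ^ n pairs. *)
Lemma kraft_prefix_free (A : finType) (P : choiceType) (Z : {fset P})
    (c : P -> seq A) (n : nat) (b : A) :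
  {in Z, forall p, size (c p) <= n} ->
  (\sum_(p <- Z) (#|A|%:R : rat) ^- size (c p) = 1)%R ->
  (forall y : nat -> A, exists2 p, p \in Z & mkseq y (size (c p)) = c p) ->
  {in Z &, forall p q, prefix (c p) (c q) -> p = q}.
Proof.
move=> leZ sumZ cover.
pose N (t : n.-tuple A) := \sum_(p <- Z) (prefix (c p) t : nat).
have sumN : \sum_t N t <= #|A| ^ n.
  rewrite exchange_big /=.
  apply: (@leq_trans (\sum_(p <- Z) #|A| ^ (n - size (c p)))).
    apply: leq_sum => p _; rewrite -big_mkcond /= sum1_card.
    exact: card_prefix_tuple.
  have A0 : (#|A|%:R != 0 :> rat)%R.
    by rewrite pnatr_eq0 -lt0n; apply/card_gt0P; exists b.
  rewrite -(ler_nat rat) natr_sum natrX -[leRHS]mulr1.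
  rewrite -[X in (_ <= _ * X)%R]sumZ mulr_sumr.
  rewrite le_eqVlt; apply/orP; left; apply/eqP; apply: eq_big_seq => p Zp.
  by rewrite natrX expfB_cond ?(negPf A0) ?leZ.
have N_gt0 t : 0 < N t.
  have [p Zp cE] := cover (nth b t); rewrite /N (big_fsetD1 p)//=.
  suff -> : prefix (c p) t by [].
  rewrite prefixE -[X in _ == X]cE; apply/eqP.
  have szt : size (take (size (c p)) t) = size (c p).
    by rewrite size_takel// size_tuple leZ.
  apply: (@eq_from_nth _ b); rewrite szt ?size_mkseq// => i lti.
  by rewrite nth_take// nth_mkseq.
(* The [#|A| ^ n] values [N t] are at least 1 and sum to at most [#|A| ^ n]. *)
have N1 t : N t = 1.
  have := leqif_sum (fun t (_ : xpredT t) => leqif_eq (N_gt0 t)).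
  rewrite sum1_card card_tuple => -[leN].
  by rewrite eqn_leq leN sumN => /esym/forallP/(_ t)/eqP.
(* Padding [c q] to length [n] gives a tuple that distinct [p] and [q] would both count. Counting
   indices rather than words also yields injectivity of [c]. *)
move=> p q Zp Zq pq; apply/eqP; apply: contraT => npq.
have sz : size (c q ++ nseq (n - size (c q)) b) == n.
  by rewrite size_cat size_nseq subnKC// leZ.
have pqt : prefix (c p) (c q ++ nseq (n - size (c q)) b).
  exact: prefix_trans pq (prefix_prefix _ _).
have := N1 (Tuple sz).
rewrite /N (big_fsetD1 p)//= (big_fsetD1 q) ?inE 1?eq_sym ?npq//=.
by rewrite pqt prefix_prefix.
Qed.

End Kraft.

(** * The strategy of Player 2 *)

Section Game.
Variable k : nat.

Lemma add_mod_inj (a : 'I_k) : injective (add_mod a).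
Proof.
move=> b b' /(congr1 val) /= /eqP; rewrite eqn_modDl !modn_small// => /eqP.
exact: val_inj.
Qed.

Lemma uncovered_player2_wins (x : nat -> {ffun 'I_k -> 'I_k})
    (Z : {fset position k}) (y : nat -> 'I_k) :
  {in Z, forall p, mkseq y (size (cseq x p)) <> cseq x p} ->
  player2_has_winning_strategy (cylinders Z).
Proof.
move=> yZ; pose b := y 0.
(* After [i] full rounds and one more action of Player 1, the answer solves the equation making
   letter [i] of [cseq] equal to [y i]. *)
exists (fun q => let i := (size q)./2 in
  invF (@add_mod_inj (x i (last b q))) (y i)) => f fcons [p Zp fp].
have {}fp : mkseq f (size p) = p := fp.
apply: (yZ p Zp); apply: (@eq_from_nth _ b); rewrite size_mkseq// size_cseq.
move=> i lti; rewrite nth_mkseq// nth_cseq//.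
have lti2 : i.*2.+1 < size p.
  rewrite -[size p]odd_double_half -doubleS.
  by apply: leq_trans (leq_addl _ _); rewrite leq_double.
have lastE : last b (mkseq f i.*2.+1) = f i.*2.
  by rewrite -nth_last size_mkseq nth_mkseq.
rewrite -fp !nth_mkseq ?(ltnW lti2)// [f i.*2.+1]fcons; last first.
  by rewrite /= odd_double.
by rewrite size_mkseq lastE [(_.+1)./2]uphalf_double f_invF.
Qed.

Lemma max_half_len_attained (Z : {fset position k}) :
  0 < max_half_len Z -> exists2 p, p \in Z & (size p)./2 = max_half_len Z.
Proof.
rewrite /max_half_len.
suff H (s : seq (position k)) : 0 < \max_(p <- s) (size p)./2 ->
    exists2 p, p \in s & (size p)./2 = \max_(p <- s) (size p)./2 by exact: H.
elim: s => [|p s IH]; rewrite ?big_nil// big_cons.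
case: (leqP _ (\max_(q <- s) _)) => [le /IH[q sq <-]|_ _].
  by exists q; rewrite // inE sq orbT.
by exists p; rewrite // mem_head.
Qed.

End Game.

Theorem theorem5p1 (k : nat) (hk : (2 <= k)%N) (Z : {fset position k})
  (hZ0 : (0 < max_half_len Z)%N)
  (hZ : (\sum_(p <- Z) (k%:R : rat) ^- (size p)./2 = 1)%R)
  (hx : exists x : nat -> {ffun 'I_k -> 'I_k},
    forall Z' : {fset position k}, (Z' `<=` Z)%fset ->
      #|` Z'|%fset = (max_half_len Z * (k - 1) + 1)%N ->
      infinite_index (subgroup_gen (Cset x Z'))) :
  player2_has_winning_strategy (cylinders Z).
Proof.
have [x xP] := hx.
have [[y yZ]|ncov] := pselect (exists y : nat -> 'I_k,
    {in Z, forall p, mkseq y (size (cseq x p)) <> cseq x p}).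
  exact: uncovered_player2_wins yZ.
have cover (y : nat -> 'I_k) :
    exists2 p, p \in Z & mkseq y (size (cseq x p)) = cseq x p.
  apply: contrapT => ny; apply: ncov; exists y => p Zp E.
  by apply: ny; exists p.
have leZ : {in Z, forall p, size (cseq x p) <= max_half_len Z}.
  by move=> p Zp; rewrite size_cseq; exact: leq_bigmax_seq.
have pfree : {in Z &, forall p q, prefix (cseq x p) (cseq x q) -> p = q}.
  (* [Ordinal hk] is the action 1, used as padding letter. *)
  apply: (kraft_prefix_free (Ordinal hk) leZ _ cover).
  by rewrite -[RHS]hZ card_ord; apply: eq_bigr => p _; rewrite size_cseq.
have [v Zv maxv] := max_half_len_attained hZ0.
pose C := [fset cseq x p | p in Z]%fset.
have [|||||D [DC cardD]] := @code_finite_index _ C (cseq x v).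
- move=> _ _ /imfsetP[p /= Zp ->] /imfsetP[q /= Zq ->] pq.
  by rewrite (pfree p q Zp Zq pq).
- move=> y; have [p Zp pE] := cover y; exists (cseq x p) => //.
  exact: in_imfset.
- exact: in_imfset.
- by rewrite size_cseq maxv.
- by move=> _ /imfsetP[p /= Zp ->]; rewrite [leqRHS]size_cseq maxv leZ.
(* By [pfree], [cseq x] is injective on [Z], so this preimage of [D] has the cardinality of [D]. *)
pose Z' := [fset p in Z | cseq x p \in D]%fset.
have Z'Z : (Z' `<=` Z)%fset by apply/fsubsetP => p; rewrite !inE => /andP[].
have DE : D = [fset cseq x p | p in Z']%fset.
  apply/fsetP => w; apply/idP/imfsetP => /= [Dw|[p + ->]].
    have /imfsetP[p /= Zp wE] := fsubsetP DC w Dw.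
    by exists p; rewrite // !inE Zp -wE.
  by rewrite !inE => /andP[].
suff -> : [set fg_seq c | c in [set` D]]%classic = Cset x Z'.
  case; apply: xP => //.
  rewrite -maxv -(size_cseq x) -[k in k - 1]card_ord -cardD DE.
  apply/esym/eqP/card_in_imfsetP => p q Z'p Z'q pq.
  by apply: pfree; rewrite ?(fsubsetP Z'Z)// pq prefix_refl.
apply/seteqP; split => [_ [w /= Dw <-]|_ [p /= Z'p <-]].
  by move: Dw; rewrite DE => /imfsetP[p /= Z'p ->]; exists p.
by exists (cseq x p) => //=; rewrite DE; exact: in_imfset.
Qed.
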